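(* Let $U$ be an infinite set with $|U| = \kappa$, $\aleph_0 \leq \kappa$. Then for every $S \subseteq U$ such that $|S| < |U|$ there exists an injective function $\star_S : U^2 \to U$ such that for every binary tree $t \in \mathsf{BT}$ with $t \neq \mathtt{nil}$, $\left|\mathit{fix}_t(\star_S)\right| = |S|$.
   Context: Binary trees: $\mathsf{BT}$ is the smallest set of terms generated by the grammar $\mathsf{bt} ::= \mathtt{nil} \mid \mathtt{bin}\ \mathsf{bt}\ \mathsf{bt}$. For a set $U$, a function $f : U^2 \to U$ and $u \in U$, define $\mathit{map}\ t\ f\ u \in U$ for $t\in\mathsf{BT}$ recursively by $\mathit{map}\ \mathtt{nil}\ f\ u = u$ and $\mathit{map}\ (\mathtt{bin}\ t_1\ t_2)\ f\ u = f(\mathit{map}\ t_1\ f\ u,\ \mathit{map}\ t_2\ f\ u)$. For $\star : U^2 \to U$ and $t \in \mathsf{BT}$, the $t$-controlled fixpoints of $\star$ are $\mathit{fix}_t(\star) = \{u \in U \mid \mathit{map}\ t\ \star\ u = u\}$. *)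

(* Defs.v *)
From mathcomp Require Import all_boot.
From mathcomp Require Import boolp classical_sets functions cardinality.

Set Implicit Arguments.
Unset Strict Implicit.
Unset Printing Implicit Defensive.

Local Open Scope classical_set_scope.
Local Open Scope card_scope.

Inductive bt : Type :=
  | bt_nil : bt
  | bt_bin : bt -> bt -> bt.

Fixpoint bt_map (U : Type) (t : bt) (f : U * U -> U) (u : U) : U :=
  match t with
  | bt_nil => u
  | bt_bin t1 t2 => f (bt_map t1 f u, bt_map t2 f u)
  end.

Definition bt_fix (U : Type) (t : bt) (star : U * U -> U) : set U :=
  [set u | bt_map t star u = u].

(* The library has no strict comparison of cardinals. *)
Definition card_lt (T U : Type) (A : set T) (B : set U) : bool :=
  (A #<= B) && (A #!= B).

Notation "A '#<' B" := (card_lt A B)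
  (at level 79, format "A  '#<'  B") : card_scope.

(* Main.v *)
(* Hessenberg's theorem gives an injection from U * U to U; as S has fewer
   elements than U, some row {u} * U is sent outside S, so U injects into ~S,
   and hence so does U * U * nat.  Let star fix the diagonal of S, and send every
   other pair (x, y) to the code of (x, y, n), where n exceeds the ranks of x
   and y, the rank of a code being its last component.  Then star is injective,
   S consists of idempotents, and outside S a nonempty tree strictly increases
   the rank, so it has no fixpoint there. *)

Require Import Defs.
From mathcomp Require Import all_boot.
From mathcomp Require Import boolp classical_sets functions cardinality.

Local Open Scope classical_set_scope.
Local Open Scope card_scope.

(** * Comparability of two sets by injections *)

Definition partial_inj {T U : Type} (A : set T) (B : set U)
    (G : set (T * U)) :=
  [/\ forall p, G p -> A p.1 /\ B p.2,
      forall x y z, G (x, y) -> G (x, z) -> y = z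
    & forall x y z, G (x, z) -> G (y, z) -> x = y].

Lemma partial_injU1 {T U : Type} (A : set T) (B : set U) G x y :
  partial_inj A B G -> A x -> (forall z, ~ G (x, z)) ->
  B y -> (forall z, ~ G (z, y)) -> partial_inj A B (G `|` [set (x, y)]).
Proof.
move=> [GAB Gf Gi] Ax Gx By Gy; split.
- by move=> p [/GAB//|->].
- move=> u v w [Guv|[-> ->]] [Guw|[]] //.
  + exact: Gf Guv Guw.
  + by move=> eux; case: (Gx v); rewrite -eux.
  + by case/Gx: Guw.
- move=> u v w [Guv|[-> ->]] [Guw|[]] //.
  + exact: Gi Guv Guw.
  + by move=> _ eux; case: (Gy u); rewrite -eux.
  + by case/Gy: Guw.
Qed.

(** Zorn's lemma on graphs of partial injections from [A] to [B]: a maximal graph is total on [A] or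
    covers [B], since otherwise an unmatched [x] could be paired with an unmatched [y]. *)
Lemma inj_or_inj {T : Type} (A B : set T) :
  (exists g : T -> T, {homo g : x / A x >-> B x} /\
     forall x y, A x -> A y -> g x = g y -> x = y) \/
  (exists g : T -> T, {homo g : x / B x >-> A x} /\
     forall x y, B x -> B y -> g x = g y -> x = y).
Proof.
have [F FP Ftot|G [[GAB Gf Gi] Gmax]] := @Zorn_bigcup _ (partial_inj A B).
  have chain p q : (\bigcup_(X in F) X) p -> (\bigcup_(X in F) X) q ->
      exists X, [/\ F X, X p & X q].
    move=> [X FX Xp] [Y FY Yq].
    by have [XY|YX] := Ftot _ _ FX FY; [exists Y|exists X]; split; auto.
  split.
  - by move=> p [X /FP[XAB _ _] /XAB].
  - move=> x y z /chain/[apply] -[X [/FP[_ Xf _]]]; exact: Xf.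
  - move=> x y z /chain/[apply] -[X [/FP[_ _ Xi]]]; exact: Xi.
have [Atot|/existsNP[x /not_implyP[Ax Gx]]] :=
    pselect (forall x, A x -> exists y, G (x, y)).
  left; have /choice[g gP] : forall x, exists y, A x -> G (x, y).
    by move=> x; have [/Atot[y Gxy]|nAx] := pselect (A x); [exists y|exists x].
  exists g; split=> [x Ax|x y Ax Ay gxy]; first by have [] := GAB _ (gP _ Ax).
  by apply: Gi (gP _ Ax) _; rewrite gxy; exact: gP.
have [Btot|/existsNP[y /not_implyP[By Gy]]] :=
    pselect (forall y, B y -> exists x, G (x, y)).
  right; have /choice[g gP] : forall y, exists x, B y -> G (x, y).
    by move=> y; have [/Btot[z Gzy]|nBy] := pselect (B y); [exists z|exists y].
  exists g; split=> [y By|y z By Bz gyz]; first by have [] := GAB _ (gP _ By).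
  by apply: Gf (gP _ By) _; rewrite gyz; exact: gP.
case: (Gmax (G `|` [set (x, y)])).
  split; first by move=> p; left.
  by move=> /(_ (x, y)) Gxy; apply: Gx; exists y; apply: Gxy; right.
by apply: partial_injU1 => // z Gz; [apply: Gx|apply: Gy]; exists z.
Qed.

(** * Hessenberg's theorem: an infinite set absorbs its square *)

Definition squaring {T : Type} (A : set T) (f : T -> T -> T) :=
  (forall x y, A x -> A y -> A (f x y)) /\
  (forall x y x' y', A x -> A y -> A x' -> A y' ->
     f x y = f x' y' -> x = x' /\ y = y').

(** Values off [A] are ignored, so this relation is not antisymmetric; hence the version of Zorn's
    lemma for preorders below. *)
Definition extends {T : Type} (A : set T) (f : T -> T -> T)
    (B : set T) (g : T -> T -> T) :=
  A `<=` B /\ forall x y, A x -> A y -> g x y = f x y.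

Lemma exists_maximal_squaring {T : choiceType} (A0 : set T) f0 :
  squaring A0 f0 ->
  exists A f, [/\ A0 `<=` A, squaring A f &
    forall B g, squaring B g -> extends A f B g -> B `<=` A].
Proof.
move=> sq0.
pose D := {d : set T * (T -> T -> T) | A0 `<=` d.1 /\ squaring d.1 d.2}.
pose R (d e : D) :=
  `[< extends (sval d).1 (sval d).2 (sval e).1 (sval e).2 >].
pose d0 : D := exist _ (A0, f0) (conj (@subset_refl _ A0) sq0).
have [|||[[A f] [/= A0A sqA]] Amax] := @ZL_preorder D d0 R.
- by move=> d; apply/asboolP; split.
- move=> d e c /asboolP[de1 de2] /asboolP[ec1 ec2]; apply/asboolP; split.
    exact: subset_trans de1 ec1.
  by move=> x y dx dy; rewrite ec2 ?de2//; exact: de1.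
- move=> C Ctot.
  have [[c0 Cc0]|C0] := pselect (exists c, C c); last first.
    by exists d0 => d Cd; case: C0; exists d.
  pose A := \bigcup_(d in C) (sval d).1.
  (* Glues the functions of the chain. The default [x] is taken only when no member contains both
     arguments; otherwise [fE] shows that the choice of member is irrelevant. *)
  pose f x y := xget x [set z | exists d : D,
    [/\ C d, (sval d).1 x, (sval d).1 y & z = (sval d).2 x y]].
  have fE d x y : C d -> (sval d).1 x -> (sval d).1 y ->
      f x y = (sval d).2 x y.
    move=> Cd dx dy; rewrite /f; case: xgetP => [z _ [e [Ce ex ey ->]]|].
      have [/asboolP[_ de]|/asboolP[_ ed]] := Ctot _ _ Cd Ce; first exact: de.
      by rewrite ed.
    by move=> /(_ ((sval d).2 x y))[]; exists d.
  have chain d e : C d -> C e ->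
      exists c : D, [/\ C c, (sval d).1 `<=` (sval c).1 &
                   (sval e).1 `<=` (sval c).1].
    move=> Cd Ce; have [/asboolP[de _]|/asboolP[ed _]] := Ctot _ _ Cd Ce.
      by exists e; split.
    by exists d; split.
  have A0A : A0 `<=` A.
    by move=> x A0x; exists c0 => //; have [+ _] := svalP c0; apply.
  have sqA : squaring A f.
    split=> [x y [d Cd dx] [e Ce ey]|x y x' y' [d Cd dx] [e Ce ey]].
      have [c [Cc dc ec]] := chain _ _ Cd Ce.
      exists c => //; rewrite (fE c) //; [|exact: dc|exact: ec].
      by have [_ [+ _]] := svalP c; apply; [exact: dc|exact: ec].
    move=> [d' Cd' dx'] [e' Ce' ey'].
    have [c1 [Cc1 dc1 ec1]] := chain _ _ Cd Ce.
    have [c2 [Cc2 dc2 ec2]] := chain _ _ Cd' Ce'.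
    have [c [Cc c1c c2c]] := chain _ _ Cc1 Cc2.
    have cx := c1c _ (dc1 _ dx); have cy := c1c _ (ec1 _ ey).
    have cx' := c2c _ (dc2 _ dx'); have cy' := c2c _ (ec2 _ ey').
    rewrite !(fE c) //.
    by have [_ [_ +]] := svalP c; apply.
  exists (exist _ (A, f) (conj A0A sqA)) => d Cd; apply/asboolP; split=> /=.
    by move=> x dx; exists d.
  by move=> x y dx dy; exact: fE.
- exists A, f; split=> // B g sqB [AB gf].
  pose e : D := exist _ (B, g) (conj (subset_trans A0A AB) sqB).
  by have /asboolP[] := Amax e (asboolT (conj AB gf)).
Qed.

(* The new pairs are those of B * B outside A * A, where B is the union of A and
   its copy g @` A.  Such a pair is coded by the two underlying elements of A and
   a tag telling which components lie in the copy, and sent to the copy. *)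
Lemma squaring_extend {T : choiceType} (A : set T) f (g : T -> T) a b c :
  squaring A f -> A a -> A b -> A c -> a <> b -> a <> c -> b <> c ->
  (forall x, A x -> ~ A (g x)) ->
  (forall x y, A x -> A y -> g x = g y -> x = y) ->
  exists h, squaring (A `|` g @` A) h /\ extends A f (A `|` g @` A) h.
Proof.
move=> [fA finj] Aa Ab Ac ab ac bc gA ginj.
set B := A `|` g @` A.
pose r x := if x \in A then x else xget x [set y | A y /\ g y = x].
(* Three tags suffice: pairs inside [A] are left to [f], so [a] means only [x] in [A], [b] only [y],
   and [c] neither. *)
pose tag x y := if x \in A then a else if y \in A then b else c.
pose h x y := if (x \in A) && (y \in A) then f x y
              else g (f (f (r x) (r y)) (tag x y)).
have rP x : B x -> A (r x) /\ x = if x \in A then r x else g (r x).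
  rewrite /r; case: (boolP (x \in A)) => [/set_mem//|/negP nAx].
  case=> [/mem_set//|[y Ay gyx]]; case: xgetP => [z _ []//|/(_ y)[]//].
have tagA x y : A (tag x y) by rewrite /tag; do 2?case: ifP.
have tag_inj x y x' y' : ~~ ((x \in A) && (y \in A)) ->
    ~~ ((x' \in A) && (y' \in A)) -> tag x y = tag x' y' ->
    (x \in A) = (x' \in A) /\ (y \in A) = (y' \in A).
  rewrite /tag; case: (x \in A); case: (y \in A);
  case: (x' \in A); case: (y' \in A) => //= _ _ e; congruence.
exists h; split; last first.
  by split=> [x Ax|x y Ax Ay]; [left|rewrite /h !mem_set].
have codeA x y : B x -> B y -> A (f (f (r x) (r y)) (tag x y)).
  by move=> /rP[? _] /rP[? _]; apply: (fA) => //; exact: fA.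
split=> [x y Bx By|x y x' y' Bx By Bx' By'].
  rewrite /h; case: ifP => [/andP[/set_mem ? /set_mem ?]|_].
    by left; exact: fA.
  by right; exists (f (f (r x) (r y)) (tag x y)) => //; exact: codeA.
rewrite /h; case: ifPn => [/andP[/set_mem Ax /set_mem Ay]|nAxy];
  case: ifPn => [/andP[/set_mem Ax' /set_mem Ay']|nAxy'].
- exact: finj.
- by move=> e; case: (gA _ (codeA _ _ Bx' By')); rewrite -e; exact: fA.
- by move=> e; case: (gA _ (codeA _ _ Bx By)); rewrite e; exact: fA.
have [Ax ex] := rP _ Bx; have [Ay ey] := rP _ By.
have [Ax' ex'] := rP _ Bx'; have [Ay' ey'] := rP _ By'.
move=> /(ginj _ _ (codeA _ _ Bx By) (codeA _ _ Bx' By')).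
move=> /(finj _ _ _ _ (fA _ _ Ax Ay) (tagA _ _) (fA _ _ Ax' Ay') (tagA _ _)).
move=> [/(finj _ _ _ _ Ax Ay Ax' Ay')[rx ry]].
move=> /(tag_inj _ _ _ _ nAxy nAxy')[mx my].
by rewrite ex ey mx my rx ry -ex' -ey'.
Qed.

Lemma infinite_set_inj_nat {T : Type} :
  infinite_set [set: T] -> exists e : nat -> T, injective e.
Proof.
elim/Ppointed: T => T; first by rewrite !emptyE => /(_ (finite_set0 _)).
move=> /infiniteP/pcard_injP[e ei]; exists e => m n.
by apply: ei; rewrite in_setE.
Qed.

(** Take a maximal [A] with an injective square, above a countable set. If [A] embedded in its
    complement, [squaring_extend] would enlarge it. So the complement embeds in [A], hence so does
    the whole type, and the pairing on [A] transfers to it. *)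
Lemma infinite_set_inj_pair {T : Type} :
  infinite_set [set: T] -> exists f : T * T -> T, injective f.
Proof.
elim/Pchoice: T => T /infinite_set_inj_nat[e ei].
pose i x := xget 0%N [set n | e n = x].
have iK n : i (e n) = n.
  by rewrite /i; case: xgetP => [m _ /ei//|/(_ n)[]].
have [|A [f [eA sqA Amax]]] := @exists_maximal_squaring T (range e)
    (fun x y => e (pickle (i x, i y))).
  split=> [x y _ _|_ _ _ _ [m _ <-] [n _ <-] [m' _ <-] [n' _ <-]].
    by eexists.
  by rewrite !iK => /ei/(pcan_inj pickleK)[-> ->].
have Ae n : A (e n) by apply: eA; exists n.
have ne m n : m != n -> e m <> e n by move=> /eqP mn /ei.
have [fA finj] := sqA.
have [[g [gA gi]]|[g [gA gi]]] := inj_or_inj A (~` A).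
  have [h [sqh /(Amax _ _ sqh) BA]] := squaring_extend A f g _ _ _ sqA
    (Ae 0) (Ae 1) (Ae 2) (ne 0 1 isT) (ne 0 2 isT) (ne 1 2 isT) gA gi.
  by case: (gA _ (Ae 0)); apply: BA; right; exists (e 0).
(* The second components [e 0] and [e 1] keep the images of [A] and of its complement apart. *)
pose k x := if x \in A then f x (e 0) else f (g x) (e 1).
have kA x : A (k x).
  rewrite /k; case: ifPn => [/set_mem ?|/negP nAx]; apply: fA => //.
  by apply: gA => /mem_set.
have ki : injective k.
  move=> x y; rewrite /k; case: ifPn => [/set_mem Ax|/negP nAx];
    case: ifPn => [/set_mem Ay|/negP nAy] fxy.
  - by have [] := finj _ _ _ _ Ax (Ae 0) Ay (Ae 0) fxy.
  - have Agy : A (g y) by apply: gA => /mem_set.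
    by have [_ /ei] := finj _ _ _ _ Ax (Ae 0) Agy (Ae 1) fxy.
  - have Agx : A (g x) by apply: gA => /mem_set.
    by have [_ /ei] := finj _ _ _ _ Agx (Ae 1) Ay (Ae 0) fxy.
  - have nAx' : ~ A x by move=> /mem_set.
    have nAy' : ~ A y by move=> /mem_set.
    have [] := finj _ _ _ _ (gA _ nAx') (Ae 1) (gA _ nAy') (Ae 1) fxy.
    by move=> /gi-/(_ nAx' nAy').
exists (fun p => f (k p.1) (k p.2)) => -[x y] [x' y'] /=.
by move=> /finj[]// /ki-> /ki->.
Qed.

(** If every row met [S], one such point per row would embed [T] in [S]. The map [k] is [j] on a row
    that avoids [S]. *)
Lemma inj_avoiding {T : Type} (S : set T) (j : T * T -> T) :
  injective j -> S #< [set: T] ->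
  exists k : T -> T, injective k /\ forall x, ~ S (k x).
Proof.
move=> ji; elim/Ppointed: T => T in S j ji *.
  by move=> _; exists id; split=> // x; case: (no x).
move=> /andP[S_le /negP S_neq].
have [u uS] : exists u, forall v, ~ S (j (u, v)).
  apply: contrapT => /forallNP row; apply: S_neq.
  have {}row u : exists v, S (j (u, v)).
    by have /existsNP[v /contrapT Suv] := row u; exists v.
  have [v vS] := choice row.
  have vi : {in [set: T] &, injective (fun u => j (u, v u))}.
    by move=> x y _ _ /ji[].
  have imS : (fun u => j (u, v u)) @` [set: T] `<=` S by move=> _ [u _ <-].
  (* Inequalities both ways give equal cardinals, against [S_neq]. *)
  rewrite card_eq_le S_le -(card_le_eql (inj_card_eq vi)).
  exact: subset_card_le imS.
by exists (fun v => j (u, v)); split=> // x y /ji[].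
Qed.

Theorem proposition11 (U : Type) (U_infinite : infinite_set [set: U])
    (S : set U) (S_lt_U : S #< [set: U]) :
  exists star : U * U -> U,
    injective star /\
    forall t : bt, t <> bt_nil -> bt_fix t star #= S.
Proof.
have [j ji] := infinite_set_inj_pair U_infinite.
have [e ei] := infinite_set_inj_nat U_infinite.
have [k [ki kS]] := inj_avoiding S j ji S_lt_U.
pose h (p : U * U) n := k (j (j p, e n)).
have hi p q m n : h p m = h q n -> p = q /\ m = n.
  by move=> /ki/ji[/ji-> /ei->].
(* Elements that are not codes get rank 0. *)
pose rank z := xget 0%N [set n | exists p, h p n = z].
have rankh p n : rank (h p n) = n.
  rewrite /rank; case: xgetP => [m _ [q /hi[_ //]]|/(_ n)[]].
  by exists p.
pose star (p : U * U) := if `[< p.1 = p.2 /\ S p.1 >] then p.1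
  else h p (maxn (rank p.1) (rank p.2)).+1.
exists star; split.
  move=> [x y] [x' y']; rewrite /star /=.
  (* The mixed cases are impossible because codes avoid [S]. *)
  case: ifPn => [/asboolP[<- Sx]|_]; case: ifPn => [/asboolP[<- Sx']|_].
  - by move=> ->.
  - by move=> ex; move: Sx; rewrite ex => /kS.
  - by move=> ex; move: Sx'; rewrite -ex => /kS.
  - by move=> /hi[].
have fixS t s : S s -> bt_map t star s = s.
  move=> Ss; elim: t => //= t1 -> t2 ->.
  by rewrite /star /= asboolT.
(* A subtree may be [bt_nil], so the induction uses the weak bound. Staying outside [S] ensures that
   [star] takes its coding branch. *)
have rank_map t u : ~ S u -> [/\ ~ S (bt_map t star u),
    (rank u <= rank (bt_map t star u))%N &
    t <> bt_nil -> (rank u < rank (bt_map t star u))%N].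
  move=> nSu; elim: t => [|t1 [nS1 le1 _] t2 [nS2 le2 _]] //=.
  rewrite /star /= asboolF; last by case.
  rewrite rankh; have lt_rank : (rank u <
      (maxn (rank (bt_map t1 star u)) (rank (bt_map t2 star u))).+1)%N.
    by rewrite ltnS leq_max le1.
  by split=> //; [exact: kS|exact: ltnW].
move=> t t_nil; rewrite (_ : bt_fix t star = S) ?card_eqxx//.
apply/seteqP; split=> [u /= fu|s Ss]; last exact: fixS.
(* A fixpoint outside [S] would have rank below itself. *)
by apply: contrapT => /(rank_map t)[_ _ /(_ t_nil)]; rewrite fu ltnn.
Qed.
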